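(* Let $\{X_j\}_{j\in\mathbb Z}$ be a zero-mean, weakly stationary, purely nondeterministic process, with normalized innovations $\{\varepsilon_j\}$, AR coefficients $\{a_k\}_{k\ge0}$, finite innovations $\{\varepsilon_{j,-m}\}$ and finite AR coefficients $\{a_{k,j}\}$. Let $n\ge0$ be an integer. (1) For every integer $m\ge0$, with $K=\{-m,\dots,n\}\setminus\{0\}$, $$\sigma^2(K)=\Bigl(\sum_{k=0}^{n}|a_{k,m+k}|^2\Bigr)^{-1},\qquad X_0-\hat X_0(K)=\Bigl(\sum_{k=0}^{n}|a_{k,m+k}|^2\Bigr)^{-1}\sum_{k=0}^{n}\overline{a_{k,m+k}}\,\varepsilon_{k,-m}.$$ (2) With $S_n=\{\dots,n-1,n\}\setminus\{0\}$ (all integers $\le n$ except $0$), $$\sigma^2(S_n)=\Bigl(\sum_{k=0}^{n}|a_{k}|^2\Bigr)^{-1},\qquad X_0-\hat X_0(S_n)=\Bigl(\sum_{k=0}^{n}|a_{k}|^2\Bigr)^{-1}\sum_{k=0}^{n}\overline{a_{k}}\,\varepsilon_{k}.$$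
   Context: All random variables are complex-valued, mean zero and in $L^2(\Omega,\mathcal F,P)$, with inner product $(U,V):=E[U\overline V]$ and norm $\lVert U\rVert:=E[|U|^2]^{1/2}$. For a set $S\subset\mathbb Z$, $\hat X_l(S)$ is the orthogonal projection of $X_l$ onto the closed linear span $\overline{\mathrm{sp}}\{X_k;k\in S\}$ (which is $\{0\}$ if $S=\emptyset$), and $\sigma^2(S):=\lVert X_0-\hat X_0(S)\rVert^2$. Infinite-past quantities: $\varepsilon_j:=(X_j-P_jX_j)/\lVert X_j-P_jX_j\rVert$, where $P_j$ is the orthogonal projection onto $\overline{\mathrm{sp}}\{X_k;k<j\}$; $b_k:=(X_0,\varepsilon_{-k})$ for $k\ge0$. ''Purely nondeterministic'' means the denominators are positive and $X_j=\sum_{k=-\infty}^{j}b_{j-k}\varepsilon_k$ in mean square for all $j$. The AR coefficients $\{a_k\}_{k\ge0}$ are defined by $\sum_{k=0}^{j}b_ka_{j-k}=\delta_{0j}$, $j\ge0$. Finite-past quantities: for $m\ge0$, $\varepsilon_{-m,-m}:=X_{-m}/\lVert X_{-m}\rVert$ and $\varepsilon_{j,-m}:=(X_j-\hat X_j(\{-m,\dots,j-1\}))/\lVert X_j-\hat X_j(\{-m,\dots,j-1\})\rVert$ for $j>-m$. Finite MA coefficients: $b_{k,j}:=(X_j,\varepsilon_{j-k,0})$, $0\le k\le j$. Finite AR coefficients $\{a_{k,j}\}_{0\le k\le j}$: defined by $\sum_{k=i}^{j}b_{j-k,j}\,a_{k-i,k}=\delta_{ij}$ for $0\le i\le j$.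 *)

(* Defs.v *)
From HB Require Import structures.
From mathcomp Require Import all_boot all_order all_algebra.
From mathcomp Require Import complex.
From mathcomp Require Import all_classical all_reals all_analysis.

Set Implicit Arguments.
Unset Strict Implicit.
Unset Printing Implicit Defensive.

Import Order.TTheory GRing.Theory Num.Theory.
Import numFieldNormedType.Exports.
Import ComplexField.Normc.

Local Open Scope classical_set_scope.
Local Open Scope ring_scope.

Section L2.
Context (d : measure_display) (T : measurableType d) (R : realType)
  (P : probability T R).
Implicit Types (U V : T -> R[i]).

Definition in_L2 U : Prop :=
  (fun w => complex.Re (U w)) \in Lfun P 2%:E /\
  (fun w => complex.Im (U w)) \in Lfun P 2%:E.

Definition cexpectation U : R[i] :=
  Complex (fine 'E_P[fun w => complex.Re (U w)])
          (fine 'E_P[fun w => complex.Im (U w)]).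

Definition inner U V : R[i] := cexpectation (fun w => U w * (V w)^*).

Definition L2norm U : R := Num.sqrt (fine 'E_P[fun w => normc (U w) ^+ 2]).

Definition normalize U : T -> R[i] :=
  fun w => U w / real_complex R (L2norm U).

End L2.

Section process.
Context (d : measure_display) (T : measurableType d) (R : realType)
  (P : probability T R) (X : int -> T -> R[i]).

Definition span (S : set int) : set (T -> R[i]) :=
  [set Y | exists (s : seq int) (c : int -> R[i]),
     (forall k, k \in s -> S k) /\ Y = (fun w => \sum_(k <- s) c k * X k w)].

Definition closed_span (S : set int) : set (T -> R[i]) :=
  [set Y | in_L2 P Y /\
     forall e : R, 0 < e -> exists2 Z, span S Z & L2norm P (Y \- Z) < e].

Definition is_proj (l : int) (S : set int) (Y : T -> R[i]) : Prop :=
  closed_span S Y /\ forall Z, closed_span S Z -> inner P (X l \- Y) Z = 0.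

(* A version of the projection, which is only determined almost surely. It
   exists, as L^2 is complete, as soon as all X_k are in L^2; the default value
   is then irrelevant. *)
Definition Xhat (l : int) (S : set int) : T -> R[i] :=
  xget (fun=> 0) (is_proj l S).

Definition sigma2 (S : set int) : R := L2norm P (X 0 \- Xhat 0 S) ^+ 2.

Definition weakly_stationary : Prop :=
  (forall j, in_L2 P (X j)) /\
  (forall h j k, inner P (X (j + h)) (X (k + h)) = inner P (X j) (X k)).

Definition zero_mean : Prop := forall j, cexpectation P (X j) = 0.

Definition innov_residual (j : int) : T -> R[i] := X j \- Xhat j `]-oo, j[.

Definition innov (j : int) : T -> R[i] := normalize P (innov_residual j).

Definition MA_coef (k : nat) : R[i] := inner P (X 0) (innov (- k%:Z)).

Definition purely_nondeterministic : Prop :=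
  (forall j, 0 < L2norm P (innov_residual j)) /\
  (forall j : int,
     (fun N : nat => L2norm P (X j \-
        (fun w => \sum_(0 <= k < N) MA_coef k * innov (j - k%:Z) w)))
     @ \oo --> (0 : R)).

Definition AR_coefs (a : nat -> R[i]) : Prop :=
  forall j : nat,
    \sum_(0 <= k < j.+1) MA_coef k * a (j - k)%N = (j == 0)%:R.

(* [fin_innov m j] is the j-th innovation for the past starting at -m. *)
Definition fin_innov (m : nat) (j : int) : T -> R[i] :=
  if j == - m%:Z then normalize P (X j)
  else normalize P (X j \- Xhat j `[- m%:Z, j - 1]).

Definition fin_MA_coef (k j : nat) : R[i] :=
  inner P (X j%:Z) (fin_innov 0 (j%:Z - k%:Z)).

(* [a k j] is a_{k,j}; its values for k > j are unconstrained. *)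
Definition fin_AR_coefs (a : nat -> nat -> R[i]) : Prop :=
  forall i j : nat, (i <= j)%N ->
    \sum_(i <= k < j.+1) fin_MA_coef (j - k) j * a (k - i)%N k = (i == j)%:R.

End process.

(* Main.v *)
(** Let [e_k] be the orthonormal innovations of index [0 <= k <= n], [a_k] the AR
    coefficients, [s^-1] the sum of the [|a_k|^2] and [W] the sum of the
    [s a_k^* e_k]. The AR relations say exactly that [(X_l, W) = s delta_(l0)] for
    every observed index [l <= n], and orthonormality gives [|W|^2 = s]. So [W]
    is orthogonal to every [X_l] with [l <> 0], while [X_0 - W] is orthogonal to
    [W]; as [W] lies in the closed span of the observed values with [X_0]
    included, [X_0 - W] is the projection of [X_0] onto the closed span of the
    others. For the finite past, the coefficients of the process started at [-m]
    are those of the process started at [0], by stationarity. *)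

Require Import Defs.
From mathcomp Require Import all_boot all_order all_algebra.
From mathcomp Require Import complex.
From mathcomp Require Import ring lra zify.
From mathcomp Require Import all_classical all_reals all_analysis.

Import Order.TTheory GRing.Theory Num.Theory.
Import numFieldNormedType.Exports.
Import ComplexField.Normc.

Local Open Scope classical_set_scope.
Local Open Scope ring_scope.

Set Implicit Arguments.
Unset Strict Implicit.
Unset Printing Implicit Defensive.

(** * Complex square-integrable variables: inner product, norm, Cauchy-Schwarz *)

Section L2_space.
Context {d : measure_display} {T : measurableType d} {R : realType}
  {P : probability T R}.
Implicit Types (U V W : T -> R[i]) (c : R[i]) (f g : T -> R).

Local Notation "x %:C" := (real_complex R x).
Local Notation Re := complex.Re.
Local Notation Im := complex.Im.
Local Notation L2 := (in_L2 P).
Local Notation nrm := (L2norm P).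

Let ReD (x y : R[i]) : Re (x + y) = Re x + Re y.
Proof. by case: x y => ? ? []. Qed.
Let ImD (x y : R[i]) : Im (x + y) = Im x + Im y.
Proof. by case: x y => ? ? []. Qed.
Let ReM (x y : R[i]) : Re (x * y) = Re x * Re y + - Im x * Im y.
Proof. by case: x y => ? ? [? ?] /=; rewrite mulNr. Qed.
Let ImM (x y : R[i]) : Im (x * y) = Re x * Im y + Im x * Re y.
Proof. by case: x y => ? ? []. Qed.
Let ReJ (x : R[i]) : Re x^* = Re x.
Proof. by case: x. Qed.
Let ImJ (x : R[i]) : Im x^* = - Im x.
Proof. by case: x. Qed.

Lemma normc_sqr (x : R[i]) : normc x ^+ 2 = Re x ^+ 2 + Im x ^+ 2.
Proof. by case: x => a b /=; rewrite sqr_sqrtr// addr_ge0// sqr_ge0. Qed.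

Lemma mul_conjc (x : R[i]) : x * x^* = (normc x ^+ 2)%:C.
Proof.
apply/eqP; rewrite eq_complex ReM ImM ReJ ImJ normc_sqr/=.
by apply/andP; split; apply/eqP; ring.
Qed.

Lemma normc_ge0 (x : R[i]) : 0 <= normc x.
Proof. by case: x => a b; exact: sqrtr_ge0. Qed.

Lemma normc_real_complex (x : R) : normc x%:C = `|x|.
Proof. by rewrite /= expr0n addr0 sqrtr_sqr. Qed.

Let EP f : R := fine 'E_P[f].

Let EPZ (a : R) f : f \in Lfun P 1 -> EP (fun w => a * f w) = a * EP f.
Proof.
move=> If; rewrite /EP -[in RHS](fineK (expectation_fin_num If))/=.
rewrite -[a * _]/(fine (a%:E * (EP f)%:E)%E) /EP (fineK (expectation_fin_num If)).
rewrite -expectationZl//; congr (fine 'E_P[_]).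
by apply/funext => w /=; rewrite mulrC.
Qed.

Let EPD f g : f \in Lfun P 1 -> g \in Lfun P 1 ->
  EP (fun w => f w + g w) = EP f + EP g.
Proof.
move=> If Ig; rewrite /EP -fineD ?expectation_fin_num//.
by rewrite -expectationD.
Qed.

Let LfunZD p (a b : R) f g : (1 <= p)%E -> f \in Lfun P p -> g \in Lfun P p ->
  (fun w => a * f w + b * g w) \in Lfun P p.
Proof.
move=> p1 If Ig.
have bIg := (Lfun_submod_closed P p1).2 b g 0 Ig (Lfun_submod_closed P p1).1.
rewrite addr0 in bIg.
exact: ((Lfun_submod_closed P p1).2 a f _ If bIg).
Qed.

Let one_le2 : (1 <= 2%:E :> \bar R)%E.
Proof. by rewrite lee_fin ler1n. Qed.

Lemma in_L2_0 : L2 (fun=> 0).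
Proof. by split; have := (Lfun_submod_closed P one_le2).1. Qed.

Lemma in_L2Z c U : L2 U -> L2 (fun w => c * U w).
Proof.
move=> [rU iU]; split.
  under eq_fun do rewrite ReM.
  exact: LfunZD.
under eq_fun do rewrite ImM addrC [X in X + _]mulrC.
under eq_fun do rewrite [X in X + _]mulrC.
exact: LfunZD.
Qed.

Lemma in_L2D U V : L2 U -> L2 V -> L2 (fun w => U w + V w).
Proof.
move=> [rU iU] [rV iV]; split.
  under eq_fun do rewrite ReD -[X in X + _]mul1r -[X in _ + X]mul1r.
  exact: LfunZD.
under eq_fun do rewrite ImD -[X in X + _]mul1r -[X in _ + X]mul1r.
exact: LfunZD.
Qed.

Lemma in_L2B U V : L2 U -> L2 V -> L2 (fun w => U w - V w).
Proof.
move=> LU LV; under eq_fun do rewrite -mulN1r.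
exact/in_L2D/in_L2Z.
Qed.

Lemma in_L2_sum (I : eqType) (s : seq I) (F : I -> T -> R[i]) :
  (forall k, k \in s -> L2 (F k)) -> L2 (fun w => \sum_(k <- s) F k w).
Proof.
elim: s => [|k s IHs] LF.
  by under eq_fun do rewrite big_nil; exact: in_L2_0.
under eq_fun do rewrite big_cons.
apply: in_L2D; first exact/LF/mem_head.
by apply: IHs => l ls; apply: LF; rewrite inE ls orbT.
Qed.

Let in_L1 U := (fun w => Re (U w)) \in Lfun P 1 /\ (fun w => Im (U w)) \in Lfun P 1.

Let in_L1_inner U V : L2 U -> L2 V -> in_L1 (fun w => U w * (V w)^*).
Proof.
move=> [rU iU] [rV iV].
have rr := Lfun2_mul_Lfun1 rU rV; have ii := Lfun2_mul_Lfun1 iU iV.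
have ri := Lfun2_mul_Lfun1 rU iV; have ir := Lfun2_mul_Lfun1 iU rV.
split.
  under eq_fun do rewrite ReM ReJ ImJ mulrNN -[X in X + _]mul1r -[X in _ + X]mul1r.
  exact: LfunZD rr ii.
under eq_fun do rewrite ImM ReJ ImJ mulrN -[X in X + _]mulN1r -[X in _ + X]mul1r.
exact: LfunZD ri ir.
Qed.

Let cexpectationD U V : in_L1 U -> in_L1 V ->
  cexpectation P (fun w => U w + V w) = cexpectation P U + cexpectation P V.
Proof.
move=> [rU iU] [rV iV]; rewrite /cexpectation.
under eq_fun do rewrite ReD.
under [X in (_ +i* fine 'E_P[X])%C]eq_fun do rewrite ImD.
by rewrite -!/(EP _) !EPD.
Qed.

Let cexpectationZ c U : in_L1 U ->
  cexpectation P (fun w => c * U w) = c * cexpectation P U.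
Proof.
move=> [rU iU]; rewrite /cexpectation.
have LZ (a : R) f : f \in Lfun P 1 -> (fun w => a * f w) \in Lfun P 1.
  move=> If; have := LfunZD a 0 (lexx 1%E) If If.
  by under eq_fun do rewrite mul0r addr0.
under eq_fun do rewrite ReM.
under [X in (_ +i* fine 'E_P[X])%C]eq_fun do rewrite ImM.
rewrite -!/(EP _) !EPD ?LZ// !EPZ//.
by case: c => a b /=; rewrite mulNr.
Qed.

Lemma innerDl U V W : L2 U -> L2 V -> L2 W ->
  inner P (fun w => U w + V w) W = inner P U W + inner P V W.
Proof.
move=> LU LV LW; rewrite /inner; under eq_fun do rewrite mulrDl.
by rewrite cexpectationD//; exact: in_L1_inner.
Qed.

Lemma innerZl c U W : L2 U -> L2 W ->
  inner P (fun w => c * U w) W = c * inner P U W.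
Proof.
move=> LU LW; rewrite /inner; under eq_fun do rewrite -mulrA.
by rewrite cexpectationZ//; exact: in_L1_inner.
Qed.

Lemma innerC U V : L2 U -> L2 V -> inner P V U = (inner P U V)^*.
Proof.
move=> LU LV; have [rUV iUV] := in_L1_inner LU LV.
rewrite /inner /cexpectation /=; congr Complex.
  by congr (fine 'E_P[_]); apply/funext => w; rewrite !ReM !ReJ !ImJ; ring.
rewrite -[RHS]mulN1r -[RHS]EPZ//.
by congr (fine 'E_P[_]); apply/funext => w; rewrite !ImM !ReJ !ImJ; ring.
Qed.

Lemma innerBl U V W : L2 U -> L2 V -> L2 W ->
  inner P (fun w => U w - V w) W = inner P U W - inner P V W.
Proof.
move=> LU LV LW; under eq_fun do rewrite -mulN1r.
by rewrite innerDl ?innerZl ?mulN1r//; exact: in_L2Z.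
Qed.

Lemma innerZr c U W : L2 U -> L2 W ->
  inner P U (fun w => c * W w) = c^* * inner P U W.
Proof.
move=> LU LW; rewrite innerC ?innerZl//; last exact: in_L2Z.
by rewrite rmorphM; congr (_ * _); exact/esym/innerC.
Qed.

Lemma innerDr U V W : L2 U -> L2 V -> L2 W ->
  inner P U (fun w => V w + W w) = inner P U V + inner P U W.
Proof.
move=> LU LV LW; rewrite innerC ?innerDl//; last exact: in_L2D.
by rewrite rmorphD; congr (_ + _); exact/esym/innerC.
Qed.

Lemma innerBr U V W : L2 U -> L2 V -> L2 W ->
  inner P U (fun w => V w - W w) = inner P U V - inner P U W.
Proof.
move=> LU LV LW; rewrite innerC ?innerBl//; last exact: in_L2B.
by rewrite rmorphB; congr (_ - _); exact/esym/innerC.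
Qed.

Lemma inner0l W : inner P (fun=> 0) W = 0.
Proof.
rewrite /inner; under eq_fun do rewrite mul0r.
by rewrite /cexpectation /= expectation_cst.
Qed.

Lemma inner_suml (I : eqType) (s : seq I) (c : I -> R[i]) (F : I -> T -> R[i]) W :
  (forall k, k \in s -> L2 (F k)) -> L2 W ->
  inner P (fun w => \sum_(k <- s) c k * F k w) W =
  \sum_(k <- s) c k * inner P (F k) W.
Proof.
move=> + LW; elim: s => [|k s IHs] LF.
  by under eq_fun do rewrite big_nil; rewrite big_nil inner0l.
have LF' l : l \in s -> L2 (F l) by move=> ls; apply: LF; rewrite inE ls orbT.
under eq_fun do rewrite big_cons.
have Lk := LF _ (mem_head _ _).
rewrite big_cons innerDl ?innerZl ?IHs//; first exact: in_L2Z.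
by apply: in_L2_sum => l /LF'; exact: in_L2Z.
Qed.

Lemma inner_sumr (I : eqType) (s : seq I) (c : I -> R[i]) (F : I -> T -> R[i]) W :
  (forall k, k \in s -> L2 (F k)) -> L2 W ->
  inner P W (fun w => \sum_(k <- s) c k * F k w) =
  \sum_(k <- s) (c k)^* * inner P W (F k).
Proof.
move=> LF LW; rewrite innerC ?inner_suml//; last first.
  by apply: in_L2_sum => l /LF; exact: in_L2Z.
rewrite rmorph_sum; apply: eq_big_seq => k /LF LFk.
by rewrite rmorphM; congr (_ * _); exact/esym/innerC.
Qed.

Lemma L2norm_ge0 U : 0 <= nrm U.
Proof. exact: sqrtr_ge0. Qed.

Let sqr_normc_eq U : (fun w => normc (U w) ^+ 2) = (fun w => Re (U w * (U w)^*)).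
Proof. by apply/funext => w; rewrite mul_conjc. Qed.

Lemma L2norm_sqr U : nrm U ^+ 2 = fine 'E_P[fun w => normc (U w) ^+ 2].
Proof.
rewrite sqr_sqrtr//; apply/fine_ge0/expectation_ge0 => w.
by rewrite exprn_ge0// normc_ge0.
Qed.

Lemma inner_diag U : inner P U U = (nrm U ^+ 2)%:C.
Proof.
rewrite L2norm_sqr sqr_normc_eq /inner /cexpectation; congr Complex.
transitivity (fine 'E_P[cst 0 : T -> R]); last by rewrite expectation_cst.
by congr (fine 'E_P[_]); apply/funext => w; rewrite mul_conjc.
Qed.

Lemma L2norm0 : nrm (fun=> 0) = 0.
Proof.
by apply/eqP; rewrite -sqrf_eq0; have := inner_diag (fun=> 0);
  rewrite inner0l => -[<-].
Qed.

(** The integral of the nonnegative function [normc (U w) ^+ 2] vanishes. This turns uniqueness of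
    projections in norm into the almost sure identities of the theorem. *)
Lemma L2norm0_ae U : L2 U -> nrm U = 0 -> {ae P, forall w, U w = 0}.
Proof.
move=> LU nU0; have [rUU _] := in_L1_inner LU LU.
pose f : T -> R := fun w => normc (U w) ^+ 2.
have If : f \in Lfun P 1 by rewrite /f sqr_normc_eq.
have If1 := (Lfun1_integrable P f).1 If.
have mf := measurable_int _ If1.
have f0 : (\int[P]_w `|(EFin \o f) w| = 0)%E.
  under eq_integral do rewrite /= ger0_norm ?exprn_ge0 ?normc_ge0//.
  have := expectation_fin_num If; move/fineK.
  by rewrite -L2norm_sqr nU0 expr0n/= unlock => <-.
have [N [mN PN0 subN]] := (ae_eq_integral_abs P measurableT mf).1 f0.
exists N; split => // w /= Uw; apply: subN => /= fw; apply: Uw.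
have [/eqP] := fw I.
by rewrite expf_eq0/= => /eqP/eq0_normc.
Qed.

Lemma L2normZ c U : L2 U -> nrm (fun w => c * U w) = normc c * nrm U.
Proof.
move=> LU; apply/eqP; rewrite -(eqrXn2 (n := 2))// ?L2norm_ge0 ?mulr_ge0
  ?normc_ge0 ?L2norm_ge0//.
apply/eqP/(@complexI R); rewrite -inner_diag innerZl// ?innerZr//; last exact: in_L2Z.
by rewrite mulrA mul_conjc inner_diag -rmorphM exprMn.
Qed.

Lemma L2normBC U V : nrm (fun w => U w - V w) = nrm (fun w => V w - U w).
Proof.
rewrite /L2norm; congr (Num.sqrt (fine 'E_P[_])); apply/funext => w.
by rewrite -normcN opprB.
Qed.

Lemma L2norm_sqrD U V : L2 U -> L2 V ->
  nrm (fun w => U w + V w) ^+ 2 =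
  nrm U ^+ 2 + 2 * Re (inner P U V) + nrm V ^+ 2.
Proof.
move=> LU LV; have LUV := in_L2D LU LV.
apply: (@complexI R); rewrite -inner_diag innerDl// !innerDr// !inner_diag.
rewrite (innerC LU LV); case: (inner P U V) => a b.
by apply/eqP; rewrite eq_complex/=; apply/andP; split; apply/eqP; ring.
Qed.

(** With [g] the pairing of [U] and [V], the squared norm of [U - t g V] is a nonnegative polynomial
    in the real number [t]; the factor [g] makes the cross term real. If [V] is not null,
    [t = nrm V ^- 2] gives the bound. *)
Lemma inner_le U V : L2 U -> L2 V -> normc (inner P U V) <= nrm U * nrm V.
Proof.
move=> LU LV; set g := inner P U V.
have ge0 (t : R) :
    0 <= nrm U ^+ 2 - 2 * t * normc g ^+ 2 + t ^+ 2 * normc g ^+ 2 * nrm V ^+ 2.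
  have := sqr_ge0 (nrm (fun w => U w + (- (t%:C * g)) * V w)).
  rewrite L2norm_sqrD// ?L2normZ//; last exact: in_L2Z.
  have -> : Re (inner P U (fun w => (- (t%:C * g)) * V w)) = - (t * normc g ^+ 2).
    rewrite innerZr// -/g ReM ReJ ImJ normc_sqr; case: g => a b /=; ring.
  rewrite normcN normcM normc_real_complex !exprMn real_normK ?num_real//.
  by move=> h; apply: le_trans h _; lra.
rewrite -(ler_pXn2r (n := 2))// ?nnegrE ?mulr_ge0 ?normc_ge0 ?L2norm_ge0//.
rewrite exprMn.
have := L2norm_ge0 V; rewrite le_eqVlt => /predU1P[V0|V_gt0].
  rewrite -V0 expr0n mulr0; have [g0|g_neq0] := eqVneq (normc g ^+ 2) 0.
    by rewrite g0.
  (* For null [V] the polynomial is affine in [t], and this [t] would give it the value [-1]. *)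
  have := ge0 ((nrm U ^+ 2 + 1) / (2 * normc g ^+ 2)).
  rewrite -V0 expr0n mulr0 addr0.
  have -> : 2 * ((nrm U ^+ 2 + 1) / (2 * normc g ^+ 2)) * normc g ^+ 2 = nrm U ^+ 2 + 1.
    by move: g_neq0; rewrite sqrf_eq0 => g_neq0; field.
  by lra.
have := ge0 (nrm V ^- 2).
have V2 : 0 < nrm V ^+ 2 by rewrite exprn_gt0.
have -> : nrm U ^+ 2 - 2 * nrm V ^- 2 * normc g ^+ 2 +
    nrm V ^- 2 ^+ 2 * normc g ^+ 2 * nrm V ^+ 2 =
    (nrm U ^+ 2 * nrm V ^+ 2 - normc g ^+ 2) / nrm V ^+ 2.
  by field; rewrite gt_eqF.
by rewrite pmulr_lge0 ?invr_gt0// subr_ge0.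
Qed.

Lemma L2norm_triangle U V : L2 U -> L2 V ->
  nrm (fun w => U w + V w) <= nrm U + nrm V.
Proof.
move=> LU LV.
rewrite -(ler_pXn2r (n := 2))// ?nnegrE ?addr_ge0 ?L2norm_ge0//.
rewrite L2norm_sqrD// sqrrD.
suff: Re (inner P U V) <= nrm U * nrm V by lra.
apply: le_trans (inner_le LU LV); apply: le_trans (ler_norm _) _.
rewrite -(ler_pXn2r (n := 2))// ?nnegrE ?normc_ge0//.
by rewrite normc_sqr real_normK ?num_real// lerDl sqr_ge0.
Qed.

Lemma L2norm_triangleB U V W : L2 U -> L2 V -> L2 W ->
  nrm (fun w => U w - W w) <=
  nrm (fun w => U w - V w) + nrm (fun w => V w - W w).
Proof.
move=> LU LV LW.
have -> : (fun w => U w - W w) = (fun w => (U w - V w) + (V w - W w)).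
  by apply/funext => w; rewrite subrKA.
by apply: L2norm_triangle; exact: in_L2B.
Qed.

Lemma inner_null U V : L2 U -> L2 V -> nrm V = 0 -> inner P U V = 0.
Proof.
move=> LU LV V0; apply/eq0_normc/le_anti.
by rewrite normc_ge0 andbT (le_trans (inner_le LU LV))// V0 mulr0.
Qed.

End L2_space.

(** * Spans, closed spans and orthogonal projections *)

Section spans.
Context {d : measure_display} {T : measurableType d} {R : realType}
  {P : probability T R} (X : int -> T -> R[i]).
Hypothesis X_L2 : forall j, in_L2 P (X j).
Implicit Types (U V W Y Z : T -> R[i]) (c : R[i]) (S : set int).

Local Notation "x %:C" := (real_complex R x).
Local Notation L2 := (in_L2 P).
Local Notation nrm := (L2norm P).
Local Notation cspan := (closed_span P X).
Local Notation span := Defs.span.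

Lemma in_L2_span S Z : span X S Z -> L2 Z.
Proof.
by move=> [s [c [_ ->]]]; apply: in_L2_sum => k _; exact: in_L2Z.
Qed.

Lemma spanZ S c Z : span X S Z -> span X S (fun w => c * Z w).
Proof.
move=> [s [b [sS ->]]]; exists s, (fun k => c * b k); split=> //.
by apply/funext => w; rewrite mulr_sumr; apply: eq_bigr => k _; rewrite mulrA.
Qed.

(** An element of a span comes with a list that may repeat indices and one coefficient per index.
    Turning repetitions into multiplicities moves two such lists to a common duplicate-free one,
    where coefficients can be added. *)
Let sum_count (s t : seq int) (F : int -> R[i]) : {subset s <= t} -> uniq t ->
  \sum_(k <- s) F k = \sum_(k <- t) F k *+ count_mem k s.
Proof.
move=> + ut; elim: s => [|x s IHs] st.
  by rewrite big_nil big1// => k _; rewrite mulr0n.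
rewrite big_cons IHs; last by move=> y ys; apply: st; rewrite inE ys orbT.
under [RHS]eq_bigr do rewrite /= mulrnDr.
rewrite big_split/=; congr (_ + _); rewrite (bigD1_seq x)//=; last exact/st/mem_head.
by rewrite eqxx mulr1n big1 ?addr0// => k /negPf; rewrite eq_sym => ->.
Qed.

Lemma spanD S Y Z : span X S Y -> span X S Z -> span X S (fun w => Y w + Z w).
Proof.
move=> [s [b [sS ->]]] [t [c [tS ->]]].
pose r := undup (s ++ t); exists r.
exists (fun k => b k *+ count_mem k s + c k *+ count_mem k t); split.
  by move=> k; rewrite mem_undup mem_cat => /orP[/sS|/tS].
apply/funext => w.
rewrite (@sum_count s r) ?(@sum_count t r) ?undup_uniq//.
- by rewrite -big_split; apply: eq_bigr => k _; rewrite mulrDl !mulrnAl.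
- by move=> k kt; rewrite mem_undup mem_cat kt orbT.
- by move=> k ks; rewrite mem_undup mem_cat ks.
Qed.

Lemma span_gen S k : S k -> span X S (X k).
Proof.
move=> Sk; exists [:: k], (fun=> 1); split; first by move=> l; rewrite inE => /eqP ->.
by apply/funext => w; rewrite big_seq1 mul1r.
Qed.

Lemma span0 S : span X S (fun=> 0).
Proof. by exists [::], (fun=> 0); split=> //; apply/funext => w; rewrite big_nil. Qed.

Lemma sub_span S S' Z : S `<=` S' -> span X S Z -> span X S' Z.
Proof. by move=> SS' [s [c [sS ->]]]; exists s, c; split => // k /sS/SS'. Qed.

(** All occurrences of [l] in the list are collected into a single coefficient. This isolates the
    contribution of the value to be interpolated. *)
Lemma span_split S l Z : span X S Z ->
  exists c, exists2 Z', span X (S `\ l) Z' & Z = (fun w => Z' w + c * X l w).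
Proof.
move=> [s [b [sS ->]]]; exists (\sum_(k <- s | k == l) b k).
exists (fun w => \sum_(k <- [seq k <- s | k != l]) b k * X k w).
  exists [seq k <- s | k != l], b; split => // k.
  by rewrite mem_filter => /andP[kl /sS]; split=> //; exact/eqP.
apply/funext => w; rewrite (bigID (fun k => k != l))/= big_filter mulr_suml.
congr (_ + _); rewrite (eq_bigl (fun k => k == l)); last by move=> k; rewrite negbK.
by apply: eq_bigr => k /eqP ->.
Qed.

Lemma span_closed_span S Z : span X S Z -> cspan S Z.
Proof.
move=> SZ; split; first exact: in_L2_span SZ.
move=> e e0; exists Z => //.
by rewrite (_ : Z \- Z = fun=> 0) ?L2norm0//; apply/funext => w /=; rewrite subrr.
Qed.

Lemma sub_closed_span S S' Z : S `<=` S' -> cspan S Z -> cspan S' Z.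
Proof.
move=> SS' [LZ aZ]; split=> // e /aZ[Y SY YZ]; exists Y => //; exact: sub_span SY.
Qed.

Lemma closed_span_closed S Y : L2 Y ->
  (forall e : R, 0 < e -> exists2 Z, cspan S Z & nrm (fun w => Y w - Z w) < e) ->
  cspan S Y.
Proof.
move=> LY aY; split=> // e e0.
have e20 : 0 < e / 2 by rewrite divr_gt0.
have [Z [LZ aZ] YZ] := aY _ e20; have [Z' SZ' ZZ'] := aZ _ e20.
exists Z' => //; have := L2norm_triangleB LY LZ (in_L2_span SZ').
move=> /le_lt_trans; apply; rewrite [ltRHS](splitr e); exact: ltrD.
Qed.

Lemma closed_spanD S Y Z : cspan S Y -> cspan S Z -> cspan S (fun w => Y w + Z w).
Proof.
move=> [LY aY] [LZ aZ]; split; first exact: in_L2D.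
move=> e e0; have e20 : 0 < e / 2 by rewrite divr_gt0.
have [Y' SY' YY'] := aY _ e20; have [Z' SZ' ZZ'] := aZ _ e20.
exists (fun w => Y' w + Z' w); first exact: spanD.
rewrite (_ : _ \- _ = fun w => (Y w - Y' w) + (Z w - Z' w)).
  apply: le_lt_trans (L2norm_triangle _ _) _.
  - exact/in_L2B/in_L2_span/SY'.
  - exact/in_L2B/in_L2_span/SZ'.
  by rewrite [ltRHS](splitr e); exact: ltrD.
by apply/funext => w /=; rewrite opprD addrACA.
Qed.

Lemma closed_spanZ S c Y : cspan S Y -> cspan S (fun w => c * Y w).
Proof.
move=> [LY aY]; split; first exact: in_L2Z.
move=> e e0; have c0 : 0 < normc c + 1 by rewrite ltr_wpDl ?normc_ge0.
have [Z SZ YZ] := aY _ (divr_gt0 e0 c0).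
exists (fun w => c * Z w); first exact: spanZ.
rewrite (_ : _ \- _ = fun w => c * (Y w - Z w)); last first.
  by apply/funext => w /=; rewrite mulrBr.
rewrite L2normZ; last exact/in_L2B/in_L2_span/SZ.
apply: le_lt_trans (_ : (normc c + 1) * nrm (Y \- Z) < e).
  by rewrite ler_wpM2r ?L2norm_ge0// lerDl.
by rewrite mulrC -ltr_pdivlMr.
Qed.

Lemma closed_spanB S Y Z : cspan S Y -> cspan S Z -> cspan S (fun w => Y w - Z w).
Proof.
move=> SY SZ; under eq_fun do rewrite -mulN1r.
exact/closed_spanD/closed_spanZ.
Qed.

Lemma closed_span_sum S (I : eqType) (s : seq I) (F : I -> T -> R[i]) :
  (forall k, k \in s -> cspan S (F k)) -> cspan S (fun w => \sum_(k <- s) F k w).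
Proof.
elim: s => [|k s IHs] SF.
  by under eq_fun do rewrite big_nil; exact/span_closed_span/span0.
under eq_fun do rewrite big_cons.
apply: closed_spanD; first exact/SF/mem_head.
by apply: IHs => l ls; apply: SF; rewrite inE ls orbT.
Qed.

Lemma closed_span_gen S k : S k -> cspan S (X k).
Proof. by move=> Sk; exact/span_closed_span/span_gen. Qed.

(** Pairing with [V] vanishes on the span and is continuous by Cauchy-Schwarz. A nonzero pairing
    would be strictly below itself in modulus; the [+ 1] in the tolerance covers a null [V]. *)
Lemma orth_closed_span S V Z : L2 V -> (forall k, S k -> inner P V (X k) = 0) ->
  cspan S Z -> inner P V Z = 0.
Proof.
move=> LV VS [LZ aZ]; apply: eq0_normc.
apply/eqP; rewrite -[_ == _]negbK; apply/negP => g0.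
have {}g0 : 0 < normc (inner P V Z) by rewrite lt_neqAle eq_sym g0 normc_ge0.
have V0 : 0 < nrm V + 1 by rewrite ltr_wpDl ?L2norm_ge0.
have [Z' SZ' ZZ'] := aZ _ (divr_gt0 g0 V0).
have LZ' := in_L2_span SZ'.
have VZ' : inner P V Z' = 0.
  case: SZ' => s [c [sS ->]]; rewrite inner_sumr// big1_seq// => k /andP[_ /sS/VS ->].
  by rewrite mulr0.
suff : normc (inner P V Z) < normc (inner P V Z) by rewrite ltxx.
have := inner_le LV (in_L2B LZ LZ').
rewrite innerBr// VZ' subr0 => /le_lt_trans; apply.
apply: (@le_lt_trans _ _ ((nrm V + 1) * nrm (Z \- Z'))).
  by rewrite ler_wpM2r ?L2norm_ge0// lerDl.
by rewrite mulrC -ltr_pdivlMr.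
Qed.

Lemma is_proj_gen l S Y : cspan S Y ->
  (forall k, S k -> inner P (fun w => X l w - Y w) (X k) = 0) ->
  is_proj P X l S Y.
Proof.
move=> SY oY; split => // Z; apply: orth_closed_span oY.
exact: in_L2B (X_L2 l) SY.1.
Qed.

(** The difference of the two candidates lies in the closed span and is also a difference of two
    residuals, so it is orthogonal to itself. *)
Lemma is_proj_uniq l S Y Z : is_proj P X l S Y -> is_proj P X l S Z ->
  nrm (fun w => Y w - Z w) = 0.
Proof.
move=> [SY oY] [SZ oZ]; have SYZ := closed_spanB SY SZ.
have : inner P (fun w => (X l w - Z w) - (X l w - Y w)) (fun w => Y w - Z w) = 0.
  rewrite innerBl; [|exact: in_L2B (X_L2 l) SZ.1|exact: in_L2B (X_L2 l) SY.1|
    exact: SYZ.1].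
  by rewrite -[RHS](subrr 0); congr (_ - _); [exact: oZ|exact: oY].
under [X in inner P X]eq_fun do rewrite opprB addrC addrA subrK.
by rewrite inner_diag => -[/eqP]; rewrite sqrf_eq0 => /eqP.
Qed.

Lemma Xhat_is_proj l S : (exists Y, is_proj P X l S Y) ->
  is_proj P X l S (Xhat P X l S).
Proof. exact: xgetPex. Qed.

(** No existence is assumed: the default value 0 of [xget] also lies in every closed span. *)
Lemma Xhat_closed_span l S : cspan S (Xhat P X l S).
Proof.
rewrite /Xhat; case: xgetP => [Y _ []//|_].
exact/span_closed_span/span0.
Qed.

(* Approximating W by Z + c X_l with Z in the span of S `\ l, the pairing with W
   forces c to be close to 1, so X_l - W is close to - Z. *)
Lemma is_proj_dual l S W (s : R) : 0 < s -> cspan S W ->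
  inner P (X l) W = s%:C -> nrm W ^+ 2 = s ->
  (forall k, S k -> k <> l -> inner P (X k) W = 0) ->
  is_proj P X l (S `\ l) (fun w => X l w - W w).
Proof.
move=> s0 [LW aW] lW WW oW; apply: is_proj_gen; last first.
  move=> k [Sk kl]; rewrite (_ : (fun w => _) = W).
    by rewrite innerC// oW// conjC0.
  by apply/funext => w; rewrite opprB addrC subrK.
apply: closed_span_closed; first exact: in_L2B.
(* [K] is the factor by which the error in approximating [W] may grow: 1 for that error itself, and
   the second summand for the deviation of the coefficient [c] of [X l] from 1. *)
move=> e e0; pose K := 1 + nrm W * nrm (X l) / s.
have K0 : 0 < K.
  by rewrite ltr_pwDl// divr_ge0 ?mulr_ge0 ?L2norm_ge0// ltW.
have [Z /span_split-/(_ l)[c [Z' SZ' ->]] WZ] := aW _ (divr_gt0 e0 K0).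
have LZ' := in_L2_span SZ'; have LcX := in_L2Z c (X_L2 l).
exists (fun w => - 1 * Z' w); first exact/closed_spanZ/span_closed_span.
have LWZ : L2 (fun w => W w - (Z' w + c * X l w)) by exact/in_L2B/in_L2D.
have Z'W : inner P Z' W = 0.
  rewrite innerC// (_ : inner P W Z' = 0) ?conjC0//.
  apply: (orth_closed_span LW (S := S `\ l)); last exact: span_closed_span.
  by move=> k [Sk kl]; rewrite innerC// oW// conjC0.
have c1 : normc (1 - c) <= nrm W / s * nrm (fun w => W w - (Z' w + c * X l w)).
  have := inner_le LWZ LW.
  rewrite innerBl//; last exact: in_L2D.
  rewrite innerDl// innerZl// Z'W lW inner_diag WW add0r.
  have -> : s%:C - c * s%:C = s%:C * (1 - c) by ring.
  rewrite normcM normc_real_complex gtr0_norm// mulrC -ler_pdivlMr//.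
  move=> /le_trans; apply.
  by rewrite le_eqVlt; apply/orP; left; apply/eqP; ring.
have -> : (fun w => X l w - W w - -1 * Z' w) =
    (fun w => (1 - c) * X l w + -1 * (W w - (Z' w + c * X l w))).
  by apply/funext => w; ring.
apply: le_lt_trans (L2norm_triangle (in_L2Z _ (X_L2 l)) (in_L2Z _ LWZ)) _.
rewrite !L2normZ// normcN normc1 mul1r.
apply: le_lt_trans (_ : K * nrm (fun w => W w - (Z' w + c * X l w)) < e).
  rewrite /K mulrDl mul1r addrC lerD2l.
  apply: le_trans (ler_wpM2r (L2norm_ge0 _) c1) _.
  by rewrite le_eqVlt; apply/orP; left; apply/eqP; ring.
by rewrite mulrC -ltr_pdivlMr.
Qed.

(** Gram-Schmidt, one index at a time: after projecting [V] and [X x] on the shorter list, the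
    component of the residual [V'] along the residual [x'] is removed. Projections on finitely many
    values thus exist as explicit combinations. *)
Lemma orth_decomposition_seq (s : seq int) V : L2 V -> exists2 Z,
  span X [set` s] Z &
  forall k, k \in s -> inner P (fun w => V w - Z w) (X k) = 0.
Proof.
elim: s V => [|x s IHs] V LV; first by exists (fun=> 0) => //; exact: span0.
have sS : [set` s] `<=` [set` x :: s] by move=> k /= ks; rewrite inE ks orbT.
have [Z SZ oZ] := IHs V LV; have [Y SY oY] := IHs (X x) (X_L2 x).
have LZ := in_L2_span SZ; have LY := in_L2_span SY.
pose V' := fun w => V w - Z w; pose x' := fun w => X x w - Y w.
have LV' : L2 V' by exact: in_L2B.
have Lx' : L2 x' by exact: in_L2B.
pose c := inner P V' x' / inner P x' x'.
have oV'Y : inner P V' Y = 0.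
  by apply: orth_closed_span (span_closed_span SY) => // k; exact: oZ.
have ox'Y : inner P x' Y = 0.
  by apply: orth_closed_span (span_closed_span SY) => // k; exact: oY.
have XE : X x = (fun w => x' w + Y w) by apply/funext => w; rewrite subrK.
exists (fun w => Z w + c * (X x w + -1 * Y w)).
  apply: spanD; first exact: sub_span SZ.
  apply/spanZ/spanD; first by apply: span_gen => /=; rewrite mem_head.
  exact/spanZ/(sub_span sS).
have -> : (fun w => V w - (Z w + c * (X x w + -1 * Y w))) = (fun w => V' w - c * x' w).
  by apply/funext => w; rewrite /V' /x'; ring.
move=> k; rewrite inE => /predU1P[->|ks]; last first.
  by rewrite innerBl ?innerZl ?oZ ?oY ?mulr0 ?subrr//; exact: in_L2Z.
have Lcx' := in_L2Z c Lx'; have Lx'Y := in_L2D Lx' LY.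
rewrite XE innerBl ?innerZl ?(innerDr _ Lx' LY)//.
rewrite oV'Y ox'Y !addr0 /c.
(* If [x'] is null, its pairing with [V'] is 0 by Cauchy-Schwarz, so there is nothing to remove and
   [c] is 0. *)
have [x'0|x'0] := eqVneq (nrm x') 0.
  by rewrite (inner_null LV' Lx')// !mul0r subr0.
rewrite mulfVK ?subrr// inner_diag.
by apply/eqP => -[/eqP]; rewrite sqrf_eq0 (negPf x'0).
Qed.

Lemma is_proj_finite (s : seq int) l S : (forall k, S k <-> k \in s) ->
  exists2 Z, span X S Z & is_proj P X l S Z.
Proof.
move=> Ss; have [Z sZ oZ] := orth_decomposition_seq s (X_L2 l).
have SZ : span X S Z by apply: sub_span sZ => k /= ks; exact/Ss.
exists Z => //; apply: is_proj_gen; first exact: span_closed_span.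
by move=> k /Ss; exact: oZ.
Qed.

Lemma in_L2_normalize U : L2 U -> L2 (normalize P U).
Proof.
by move=> LU; rewrite /normalize; under eq_fun do rewrite mulrC; exact: in_L2Z.
Qed.

Lemma inner_normalizer U V : L2 U -> L2 V ->
  inner P U (normalize P V) = inner P U V / (nrm V)%:C.
Proof.
move=> LU LV; rewrite /normalize; under eq_fun do rewrite mulrC.
by rewrite innerZr// fmorphV mulrC; congr (_ / _); exact: conjc_real.
Qed.

Lemma inner_normalize U V : L2 U -> L2 V ->
  inner P (normalize P U) V = inner P U V / (nrm U)%:C.
Proof.
by move=> LU LV; rewrite /normalize; under eq_fun do rewrite mulrC;
  rewrite innerZl// mulrC.
Qed.

Lemma inner_normalize_diag U : L2 U -> nrm U != 0 ->
  inner P (normalize P U) (normalize P U) = 1.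
Proof.
move=> LU U0; rewrite inner_normalizer ?inner_normalize//; last exact: in_L2_normalize.
have UC0 : (nrm U)%:C != 0 by rewrite fmorph_eq0.
by rewrite inner_diag rmorphXn expr2 mulfK// divff.
Qed.

Lemma closed_span_normalize S U : cspan S U -> cspan S (normalize P U).
Proof.
by move=> SU; rewrite /normalize; under eq_fun do rewrite mulrC; exact: closed_spanZ.
Qed.

End spans.

(** * The interpolation error as a rescaled dual vector *)

Section interpolation.
Context {d : measure_display} {T : measurableType d} {R : realType}
  {P : probability T R} (X : int -> T -> R[i]).
Hypothesis X_L2 : forall j, in_L2 P (X j).
Implicit Types (U V W Y Z : T -> R[i]) (c : R[i]) (S : set int).

Local Notation "x %:C" := (real_complex R x).
Local Notation L2 := (in_L2 P).
Local Notation nrm := (L2norm P).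
Local Notation cspan := (closed_span P X).

Lemma L2norm_eq U V : L2 U -> L2 V -> nrm (fun w => U w - V w) = 0 ->
  nrm U = nrm V.
Proof.
move=> LU LV UV0; have le0 U' V' : L2 U' -> L2 V' ->
    nrm (fun w => U' w - V' w) = 0 -> nrm U' <= nrm V'.
  move=> LU' LV' UV'.
  have := L2norm_triangle (in_L2B LU' LV') LV'.
  by under eq_fun do rewrite subrK; rewrite UV' add0r.
by apply/le_anti; rewrite !le0// L2normBC.
Qed.

(** Common core of the finite and infinite past: [e] is an orthonormal system in the observed space
    with [X 0] included, and the last hypothesis is the form taken by the AR relations once MA
    coefficients are read as pairings with innovations. *)
Lemma interpolation_error S (e : nat -> T -> R[i]) (a : nat -> R[i]) (n : nat) :
  S 0 ->
  (forall k, (k <= n)%N -> cspan S (e k)) ->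
  (forall j k, (j <= n)%N -> (k <= n)%N -> inner P (e j) (e k) = (j == k)%:R) ->
  (forall l, S l -> \sum_(0 <= k < n.+1) a k * inner P (X l) (e k) = (l == 0)%:R) ->
  let s := (\sum_(0 <= k < n.+1) normc (a k) ^+ 2)^-1 in
  sigma2 P X (S `\ 0) = s /\
  {ae P, forall w, X 0 w - Xhat P X 0 (S `\ 0) w =
     s%:C * \sum_(0 <= k < n.+1) (a k)^* * e k w}.
Proof.
move=> S0 Se ee aX s; set A := (\sum_(0 <= k < n.+1) _) in s *.
have Le k : k \in index_iota 0 n.+1 -> L2 (e k).
  by rewrite mem_index_iota => /= kn; exact: (Se k kn).1.
(* If all [a k] vanished, the relation at [l = 0] would read [0 = 1]. *)
have A_gt0 : 0 < A.
  rewrite lt_neqAle sumr_ge0 ?andbT; last by move=> k _; rewrite sqr_ge0.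
  rewrite eq_sym; apply/eqP => A0.
  have := aX 0 S0; rewrite eqxx big1_seq; first by move/eqP; rewrite eq_sym oner_eq0.
  move=> k /andP[_ kn]; suff -> : a k = 0 by rewrite mul0r.
  apply: eq0_normc; apply/eqP; rewrite -sqrf_eq0; apply/eqP.
  move/eqP: A0; rewrite /A psumr_eq0; last by move=> ? _; rewrite sqr_ge0.
  by move=> /allP/(_ _ kn)/eqP.
have s_gt0 : 0 < s by rewrite invr_gt0.
(* [V] is dual to [X 0]: its pairings with the observed values are 1 at index 0 and 0 elsewhere. Its
   squared norm is [A], so scaling by [s], the inverse of [A], equates the squared norm of [W] with
   its pairing with [X 0]. *)
pose V w := \sum_(0 <= k < n.+1) (a k)^* * e k w.
pose W w := s%:C * V w.
have SV : cspan S V.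
  apply: (@closed_span_sum _ _ _ P X X_L2 S _ _ (fun k w => (a k)^* * e k w)) => k.
  by rewrite mem_index_iota => /= kn; exact/closed_spanZ/Se.
have SW : cspan S W by exact: closed_spanZ.
have LV := SV.1; have LW := SW.1.
have XV l : S l -> inner P (X l) V = (l == 0)%:R.
  move=> Sl; rewrite -aX// /V inner_sumr//; apply: eq_bigr => k _.
  by rewrite conjCK.
have XW l : S l -> inner P (X l) W = s%:C * (l == 0)%:R.
  move=> Sl; rewrite innerZr// ?XV//.
  by congr (_ * _); exact: conjc_real.
have VV : inner P V V = A%:C.
  rewrite {1}/V inner_suml//.
  rewrite rmorph_sum; apply: eq_big_seq => k kn.
  rewrite inner_sumr//; last exact: Le.
  rewrite (bigD1_seq k) ?iota_uniq//= big1_seq ?addr0.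
    by rewrite ee// ?eqxx ?mulr1 ?conjCK 1?mulrC ?mul_conjc//;
      move: kn; rewrite mem_index_iota.
  move=> j /andP[jk jn]; move: kn jn; rewrite !mem_index_iota => /= kn jn.
  by rewrite ee// eq_sym (negPf jk) mulr0.
have WW : nrm W ^+ 2 = s.
  apply: (@complexI R); rewrite -inner_diag innerZl ?innerZr ?VV//.
  rewrite [s%:C^*]conjc_real -!rmorphM /s mulVf ?mulr1//; exact: lt0r_neq0.
have projW : is_proj P X 0 (S `\ 0) (fun w => X 0 w - W w).
  apply: (is_proj_dual X_L2 s_gt0 SW _ WW) => //; first by rewrite XW// eqxx mulr1.
  by move=> k Sk /eqP k0; rewrite XW// (negPf k0) mulr0.
(* The explicit projection shows that [Xhat] is not the default value; by uniqueness the two differ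
   by a null variable. *)
have projX := Xhat_is_proj (ex_intro _ _ projW).
have L0 := X_L2 0; have LX := projX.1.1.
have D0 := is_proj_uniq X_L2 projX projW.
split.
  rewrite /sigma2 -WW; congr (_ ^+ 2); apply: L2norm_eq => //; first exact: in_L2B.
  rewrite -D0 L2normBC; congr (nrm _); apply/funext => w /=; ring.
have [N [mN PN0 subN]] := L2norm0_ae (in_L2B LX projW.1.1) D0.
exists N; split => // w /= h; apply: subN => /= h0; apply: h.
rewrite -[RHS]subr0 -[X in _ = _ - X]h0 /W /V; ring.
Qed.

(** The projection [Y] is orthogonal to the residual, so it may be subtracted from [X l] in the
    first slot. The norm of a residual is thus determined by pairings with the process. *)
Lemma inner_residual l S Y : is_proj P X l S Y ->
  inner P (X l) (fun w => X l w - Y w) = (nrm (fun w => X l w - Y w) ^+ 2)%:C.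
Proof.
move=> [SY oY]; have LY := SY.1; have LD := in_L2B (X_L2 l) LY.
rewrite -inner_diag [in RHS]innerBl//.
by rewrite (innerC LD LY) [X in X^*](oY _ SY) conjC0 subr0.
Qed.

Lemma residual_orth l S Y k : is_proj P X l S Y -> S k ->
  inner P (X k) (normalize P (fun w => X l w - Y w)) = 0.
Proof.
move=> [SY oY] Sk; have LD := in_L2B (X_L2 l) SY.1.
rewrite inner_normalizer// innerC// [X in X^*](oY _ (closed_span_gen X_L2 Sk)).
by rewrite conjC0 mul0r.
Qed.

Lemma residual_closed_span l S S' Y : is_proj P X l S Y -> S `<=` S' -> S' l ->
  cspan S' (normalize P (fun w => X l w - Y w)).
Proof.
move=> [SY _] SS' S'l; apply/closed_span_normalize/closed_spanB => //.
  exact: closed_span_gen.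
exact: sub_closed_span SY.
Qed.

End interpolation.

(** * Finite past: shift to the origin and interpolation *)

Section finite_past.
Context {d : measure_display} {T : measurableType d} {R : realType}
  {P : probability T R} (X : int -> T -> R[i]).
Hypothesis X_stat : weakly_stationary P X.
Implicit Types (U V W Y Z : T -> R[i]) (c : R[i]) (S : set int).

Local Notation "x %:C" := (real_complex R x).
Local Notation L2 := (in_L2 P).
Local Notation nrm := (L2norm P).
Local Notation cspan := (closed_span P X).
Local Notation span := Defs.span.

Let X_L2 : forall j, in_L2 P (X j) := X_stat.1.

Lemma itv_int_seq (a b : int) :
  exists s : seq int, forall k, `[a, b]%classic k <-> k \in s.
Proof.
(* The absolute value keeps the length meaningful when [b < a]; the filter then discards every
   candidate. *)
pose t := [seq a + i%:Z | i <- iota 0 `|b - a|.+1].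
exists [seq k <- t | a <= k <= b] => k.
rewrite mem_filter /= in_itv /=; split=> [/andP[ak kb]|/andP[]//].
rewrite ak kb/=; apply/mapP; exists `|k - a|%N; last lia.
by rewrite mem_iota; lia.
Qed.

Lemma is_proj_itv l (a b : int) :
  exists2 Z, span X `[a, b] Z & is_proj P X l `[a, b] Z.
Proof. by have [s sab] := itv_int_seq a b; exact: is_proj_finite sab. Qed.

(** The same coefficients are applied to shifted indices, and stationarity preserves every inner
    product. Membership in the span itself, not only in its closure, supplies these coefficients. *)
Lemma is_proj_shift l (h : int) S Z : span X S Z -> is_proj P X l S Z ->
  exists2 Z', is_proj P X (l + h) [set k | S (k - h)] Z' &
  forall i, inner P (X (i + h)) (fun w => X (l + h) w - Z' w) =
            inner P (X i) (fun w => X l w - Z w).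
Proof.
move=> [s [b [sS ->]]] [SZ oZ].
pose Z' w := \sum_(k <- s) b k * X (k + h) w.
have LZ : L2 (fun w => \sum_(k <- s) b k * X k w) by exact: SZ.1.
have SZ' : span X [set k | S (k - h)] Z'.
  exists [seq k + h | k <- s], (fun k => b (k - h)); split.
    by move=> _ /mapP[k /sS Sk ->] /=; rewrite addrK.
  by apply/funext => w; rewrite big_map; apply: eq_bigr => k _; rewrite addrK.
have LZ' := in_L2_span X_L2 SZ'.
have E i : inner P (X (i + h)) (fun w => X (l + h) w - Z' w) =
    inner P (X i) (fun w => X l w - \sum_(k <- s) b k * X k w).
  rewrite !innerBr//; congr (_ - _); first exact: X_stat.2.
  rewrite /Z' !inner_sumr//; apply: eq_bigr => k _; congr (_ * _).
  exact: X_stat.2.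
exists Z' => //; apply: (is_proj_gen X_L2); first exact: span_closed_span.
move=> k /= Sk; rewrite innerC//; last exact: in_L2B.
rewrite -[k](subrK h) E -innerC//; last exact: in_L2B.
by apply: oZ; exact: closed_span_gen.
Qed.

Lemma fin_innovE (m : nat) (j : int) : - m%:Z <= j -> exists2 Y,
  is_proj P X j `[- m%:Z, j - 1] Y &
  fin_innov P X m j = normalize P (fun w => X j w - Y w).
Proof.
(* At [j = - m] the interval of past indices is empty and the projection is 0, so the first
   innovation has the general form. *)
move=> mj; rewrite /fin_innov; case: eqVneq => [->|_].
  exists (fun=> 0); last by congr (normalize P _); apply/funext => w; rewrite subr0.
  apply: is_proj_gen => //; first exact/span_closed_span/span0.
  by move=> k /=; rewrite in_itv/=; lia.
exists (Xhat P X j `[- m%:Z, j - 1]) => //.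
by apply: Xhat_is_proj; have [Z _ pZ] := is_proj_itv j (- m%:Z) (j - 1); exists Z.
Qed.

Lemma inner_fin_innov_shift (m : nat) (i j : int) : - m%:Z <= j ->
  inner P (X i) (fin_innov P X m j) =
  inner P (X (i + m%:Z)) (fin_innov P X 0 (j + m%:Z)).
Proof.
move=> mj; have [Y pY ->] := fin_innovE mj.
have m0j : - 0%:Z <= j + m%:Z by lia.
have [Y' pY' ->] := fin_innovE m0j.
(* [Y] and [Y'] are only known to lie in closed spans. The shift is carried out on a finite
   combination [Z], and [same] transports pairings between versions of one projection. *)
have [Z sZ pZ] := is_proj_itv j (- m%:Z) (j - 1).
have [Z' pZ' EZ] := is_proj_shift m%:Z sZ pZ.
have pZ'' : is_proj P X (j + m%:Z) `[- 0%:Z, j + m%:Z - 1] Z'.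
  rewrite (_ : `[- 0%:Z, _]%classic = [set k | `[- m%:Z, j - 1]%classic (k - m%:Z)])//.
  by apply/seteqP; split=> k /=; rewrite !in_itv/=; lia.
have same l S U V k : is_proj P X l S U -> is_proj P X l S V ->
    inner P (X k) (fun w => X l w - U w) = inner P (X k) (fun w => X l w - V w).
  move=> pU pV; have LU := pU.1.1; have LV := pV.1.1.
  rewrite !innerBr//; congr (_ - _); apply/eqP; rewrite -subr_eq0 -innerBr//.
  apply/eqP/inner_null => //; first exact: in_L2B.
  exact: is_proj_uniq pU pV.
have E k : inner P (X (k + m%:Z)) (fun w => X (j + m%:Z) w - Y' w) =
    inner P (X k) (fun w => X j w - Y w).
  by rewrite (same _ _ _ _ _ pY' pZ'') (same _ _ _ _ _ pY pZ).
have LD := in_L2B (X_L2 j) pY.1.1.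
have LD' := in_L2B (X_L2 (j + m%:Z)) pY'.1.1.
have nE : nrm (fun w => X (j + m%:Z) w - Y' w) = nrm (fun w => X j w - Y w).
  apply/eqP; rewrite -(eqrXn2 (n := 2)) ?L2norm_ge0//; apply/eqP/(@complexI R).
  by rewrite -(inner_residual X_L2 pY) -(inner_residual X_L2 pY') E.
by rewrite !inner_normalizer// nE E.
Qed.

(** The coefficients are defined for a past starting at 0; this reads them off the past starting at
    [- m]. *)
Lemma fin_MA_coefE (m i j : nat) : (i <= j + m)%N ->
  fin_MA_coef P X i (j + m) = inner P (X j%:Z) (fin_innov P X m (j%:Z - i%:Z)).
Proof.
move=> ijm; rewrite inner_fin_innov_shift; last lia.
by rewrite /fin_MA_coef; congr (inner P (X _) (fin_innov P X 0 _)); lia.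
Qed.

Lemma inner_fin_innov_gt (m : nat) (i j : int) : - m%:Z <= i -> i < j ->
  inner P (X i) (fin_innov P X m j) = 0.
Proof.
move=> mi ij; have mj : - m%:Z <= j by lia.
have [Y pY ->] := fin_innovE mj.
by apply: (residual_orth X_L2 pY) => /=; rewrite in_itv/=; lia.
Qed.

Lemma fin_innov_closed_span (m : nat) (j b : int) : - m%:Z <= j -> j <= b ->
  cspan `[- m%:Z, b] (fin_innov P X m j).
Proof.
move=> mj jb; have [Y pY ->] := fin_innovE mj.
apply: (residual_closed_span X_L2 pY) => [k|]/=; rewrite !in_itv/=; lia.
Qed.

Lemma fin_innov_ortho (m : nat) (i j : int) : - m%:Z <= i -> i < j ->
  inner P (fin_innov P X m i) (fin_innov P X m j) = 0.
Proof.
move=> mi ij; have mj : - m%:Z <= j by lia.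
have Si := fin_innov_closed_span mi (lexx i).
have Lj := (fin_innov_closed_span mj (lexx j)).1.
rewrite innerC//; last exact: Si.1.
rewrite (orth_closed_span X_L2 Lj _ Si) ?conjC0// => k /=; rewrite in_itv/= => ki.
by rewrite innerC// inner_fin_innov_gt ?conjC0//; lia.
Qed.

(** Normalizing a null residual divides by 0, which yields 0 and hence a zero pairing; a nonzero
    pairing excludes this. *)
Lemma fin_innov_unit (m : nat) (j : int) : - m%:Z <= j ->
  inner P (X j) (fin_innov P X m j) != 0 ->
  inner P (fin_innov P X m j) (fin_innov P X m j) = 1.
Proof.
move=> mj; have [Y pY ->] := fin_innovE mj.
have LD := in_L2B (X_L2 j) pY.1.1.
rewrite inner_normalizer// => h; apply: inner_normalize_diag => //.
by apply: contraNneq h => ->; rewrite invr0 mulr0.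
Qed.

Theorem finite_past_interpolation (a : nat -> nat -> R[i]) (m n : nat) :
  fin_AR_coefs P X a ->
  let K : set int := `[- m%:Z, n%:Z] `\ 0 in
  let s : R := (\sum_(0 <= k < n.+1) normc (a k (m + k)%N) ^+ 2)^-1 in
  sigma2 P X K = s /\
  {ae P, forall w, X 0 w - Xhat P X 0 K w =
     s%:C * \sum_(0 <= k < n.+1) (a k (m + k)%N)^* * fin_innov P X m k%:Z w}.
Proof.
move=> aAR K s.
have Le (k : nat) : L2 (fin_innov P X m k%:Z).
  have mk : - m%:Z <= k%:Z by lia.
  exact: (fin_innov_closed_span mk (lexx _)).1.
apply: (interpolation_error X_L2 (e := fun k => fin_innov P X m k%:Z)
  (a := fun k => a k (m + k)%N)).
- by rewrite /= in_itv/=; lia.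
- by move=> k kn; apply: fin_innov_closed_span; lia.
- move=> j k jn kn; case: (ltngtP j k) => [jk|kj|<-].
  + by rewrite fin_innov_ortho//; lia.
  + by rewrite innerC// fin_innov_ortho ?conjC0//; lia.
  + apply: fin_innov_unit; first lia.
    (* The diagonal AR relation is a product equal to 1 whose first factor is the pairing of [X j]
       with its innovation, so that pairing is nonzero. *)
    have := aAR (j + m)%N (j + m)%N (leqnn _).
    rewrite big_nat1 !subnn fin_MA_coefE// subr0 eqxx => h.
    by apply: contra_eq_neq h => ->; rewrite mul0r eq_sym oner_eq0.
(* A negative index precedes all the innovations used, so every pairing is 0. For an index [j >= 0]
   the terms with [k > j] vanish, and the others form the AR relation between [m] and [j + m], with
   summation index shifted by [m]. *)
- move=> [j|j] /=; rewrite in_itv/= => mjn; last first.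
    by rewrite big1// => k _; rewrite inner_fin_innov_gt ?mulr0//; lia.
  rewrite (big_cat_nat (n := j.+1))//=; last lia.
  rewrite [X in _ + X]big1_seq ?addr0; last first.
    move=> k; rewrite mem_index_iota => /andP[_ /andP[jk _]].
    by rewrite inner_fin_innov_gt ?mulr0//; lia.
  have := aAR m (j + m)%N (leq_addl _ _).
  rewrite -addSn -{1}[m]add0n big_addn addnK => h.
  transitivity ((m == (j + m)%N)%:R : R[i]); last by congr (_%:R); lia.
  rewrite -h; apply: eq_big_nat => k /andP[_ kj].
  rewrite mulrC addnK [(k + m)%N]addnC fin_MA_coefE; last lia.
  by congr (_ * _); congr (inner P _ (fin_innov P X m _)); lia.
Qed.

End finite_past.

(** * Infinite past: existence of projections, innovations and interpolation *)

Section infinite_past.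
Context {d : measure_display} {T : measurableType d} {R : realType}
  {P : probability T R} (X : int -> T -> R[i]).
Hypothesis X_stat : weakly_stationary P X.
Hypothesis X_pnd : purely_nondeterministic P X.
Implicit Types (U V W Y Z : T -> R[i]) (c : R[i]) (S : set int).

Local Notation "x %:C" := (real_complex R x).
Local Notation L2 := (in_L2 P).
Local Notation nrm := (L2norm P).
Local Notation cspan := (closed_span P X).
Local Notation eps := (innov P X).
Local Notation b := (MA_coef P X).

Let X_L2 : forall j, in_L2 P (X j) := X_stat.1.

(** [Xhat] lies in the closed past whether or not the projection exists, so this is available before
    existence is proved. *)
Lemma innov_closed_span (j : int) S : [set k | k <= j] `<=` S -> cspan S (eps j).
Proof.
move=> jS; apply/closed_span_normalize/closed_spanB => //.
  by apply: closed_span_gen => //; apply: jS => /=.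
apply: sub_closed_span (Xhat_closed_span _ _ _) => // k /=.
by rewrite in_itv/= => kj; apply: jS => /=; exact: ltW.
Qed.

Let eps_L2 j : L2 (eps j).
Proof. exact: (@innov_closed_span j [set k | k <= j] _).1. Qed.

Let residual_L2 j : L2 (innov_residual P X j).
Proof. by apply: in_L2B => //; exact: (Xhat_closed_span X_L2 _ _).1. Qed.

Let MA_sum j (m n : nat) w := \sum_(m <= k < n) b k * eps (j - k%:Z) w.

Let MA_sum_closed_span j (m n : nat) S : [set k | k <= j - m%:Z] `<=` S ->
  cspan S (MA_sum j m n).
Proof.
move=> jS; apply: (closed_span_sum X_L2 (F := fun k w => b k * eps (j - k%:Z) w)) => k.
rewrite mem_index_iota => /andP[mk _]; apply/closed_spanZ/innov_closed_span => //.
by move=> l /= lj; apply: jS => /=; lia.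
Qed.

Let MA_sum_L2 j m n : L2 (MA_sum j m n).
Proof. exact: (@MA_sum_closed_span j m n setT _).1. Qed.

Lemma MA_approx (j : int) (e : R) : 0 < e -> exists N0, forall N, (N0 <= N)%N ->
  nrm (fun w => X j w - \sum_(0 <= k < N) b k * eps (j - k%:Z) w) < e.
Proof.
move=> e0; have /cvgr0Pnorm_lt/(_ _ e0)[N0 _ h] := X_pnd.2 j.
by exists N0 => N /h /=; rewrite ger0_norm// L2norm_ge0.
Qed.

Lemma is_proj_self l S : cspan S (X l) -> is_proj P X l S (X l).
Proof.
move=> Sl; split => // Z _.
by rewrite (_ : X l \- X l = fun=> 0) ?inner0l//; apply/funext => w /=; rewrite subrr.
Qed.

(** [X j] is a multiple of its innovation plus [Xhat], which always lies in the closed past. *)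
Lemma innov_past j : cspan `]-oo, j[ (eps j) -> cspan `]-oo, j[ (X j).
Proof.
move=> Sj; have nj0 : (nrm (innov_residual P X j))%:C != 0.
  by rewrite fmorph_eq0 gt_eqF// X_pnd.1.
have -> : X j = (fun w => (nrm (innov_residual P X j))%:C * eps j w +
    Xhat P X j `]-oo, j[ w).
  by apply/funext => w; rewrite /innov /normalize mulrC divfK// /innov_residual /= subrK.
by apply/closed_spanD/Xhat_closed_span/X_L2 => //; exact: closed_spanZ.
Qed.

(** When the projection exists, the innovation is orthogonal to the past; lying in it as well, it
    would be orthogonal to itself, against its unit norm. *)
Lemma proj_innov_past j Y : is_proj P X j `]-oo, j[ Y -> ~ cspan `]-oo, j[ (eps j).
Proof.
move=> pY Sj; have [_ oX] : is_proj P X j `]-oo, j[ (Xhat P X j `]-oo, j[).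
  by apply: Xhat_is_proj; exists Y.
have := inner_normalize_diag (residual_L2 j) (lt0r_neq0 (X_pnd.1 j)).
rewrite {1}/normalize -/(innov P X j).
have := inner_normalize (residual_L2 j) (eps_L2 j).
rewrite [X in X / _](oX _ Sj) mul0r => -> /eqP.
by rewrite eq_sym oner_eq0.
Qed.

(* This avoids the completeness of L2: if the projection failed to exist, Xhat would
   be its default value 0 and the innovation at j a multiple of X_j. The moving
   average expansion of X_j then either puts X_j or an earlier innovation into
   its own closed past, where projections trivially exist, or has all coefficients
   but the first equal to 0, so that X is a white noise and 0 is a projection. *)
Lemma past_proj_exists (j : int) : exists Y, is_proj P X j `]-oo, j[ Y.
Proof.
apply: contrapT => noproj.
have notpast : ~ cspan `]-oo, j[ (X j).
  by move=> Sj; apply: noproj; exists (X j); exact: is_proj_self.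
pose p := (nrm (innov_residual P X j))%:C.
have p0 : p != 0 by rewrite fmorph_eq0 gt_eqF// X_pnd.1.
have epsE w : eps j w = p^-1 * X j w.
  rewrite /innov /normalize -/p mulrC /innov_residual /=; congr (_ * _).
  rewrite /Xhat; case: xgetP => [Y _ pY|_]; last by rewrite subr0.
  by case: noproj; exists Y.
(* Otherwise the lag-0 term leaves a nonzero multiple [c] of [X j], which is then a limit of sums
   over lags at least 1, all in the past of [j]. *)
have b0 : b 0 = p.
  apply/eqP; rewrite -subr_eq0 -[_ == _]negbK; apply/negP => bp; apply: notpast.
  pose c := 1 - b 0 / p.
  have c0 : c != 0.
    rewrite /c -(divff p0) -mulrBl mulf_neq0 ?invr_eq0//.
    by rewrite -opprB oppr_eq0.
  have nc0 : 0 < normc c.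
    by rewrite lt_neqAle normc_ge0 andbT eq_sym; apply: contra_neq c0; exact: eq0_normc.
  apply: closed_span_closed => // e e0.
  have [N0 hN] := MA_approx j (mulr_gt0 nc0 e0).
  exists (fun w => c^-1 * MA_sum j 1 N0.+1 w).
    by apply/closed_spanZ/MA_sum_closed_span => // k /=; rewrite in_itv/=; lia.
  have := hN N0.+1 (leqnSn _).
  rewrite (_ : (fun w => X j w - \sum_(0 <= k < N0.+1) _) =
      fun w => c * (X j w - c^-1 * MA_sum j 1 N0.+1 w)).
    by rewrite L2normZ ?ltr_pM2l//; apply: in_L2B => //; exact: in_L2Z.
  apply/funext => w; rewrite big_ltn// subr0 epsE -/(MA_sum j 1 N0.+1 w).
  by rewrite mulrBr mulVKf// /c; ring.
(* Strong induction: the lag-0 term cancels [X j] and the lags between 0 and [k] vanish. A nonzero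
   [b k] would then make the innovation at [j - k] a limit of sums over later lags, hence part of
   its own past. *)
have bk k : (0 < k)%N -> b k = 0.
  elim/ltn_ind: k => k IHk k0; apply/eqP; rewrite -[_ == _]negbK; apply/negP => bk0.
  have nbk0 : 0 < normc (b k).
    by rewrite lt_neqAle normc_ge0 andbT eq_sym; apply: contra_neq bk0; exact: eq0_normc.
  have Sk : cspan `]-oo, (j - k%:Z)[ (eps (j - k%:Z)).
    apply: closed_span_closed => // e e0.
    have [N0 hN] := MA_approx j (mulr_gt0 nbk0 e0).
    pose N := (N0 + k.+1)%N.
    exists (fun w => - (b k)^-1 * MA_sum j k.+1 N w).
      by apply/closed_spanZ/MA_sum_closed_span => // l /=; rewrite in_itv/=; lia.
    have := hN N (leq_addr _ _).
    rewrite (_ : (fun w => X j w - \sum_(0 <= k < N) _) =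
        fun w => - b k * (eps (j - k%:Z) w - - (b k)^-1 * MA_sum j k.+1 N w)).
      rewrite L2normZ ?normcN ?ltr_pM2l//; apply: in_L2B => //; exact: in_L2Z.
    apply/funext => w; rewrite (big_cat_nat (n := k.+1))//=; last by rewrite /N; lia.
    rewrite big_nat_recr//= big_ltn// big_nat big1 => [|l /andP[l0 lk]]; last first.
      by rewrite IHk ?mul0r.
    rewrite addr0 subr0 epsE b0 mulVKf// -/(MA_sum j k.+1 N w).
    by rewrite mulrBr [X in _ = _ - X]mulrA mulrNN divff// mul1r; ring.
  have := is_proj_self (innov_past Sk).
  by move=> /proj_innov_past; exact.
have XE i : nrm (fun w => X i w - b 0 * eps i w) = 0.
  apply/le_anti; rewrite L2norm_ge0 andbT leNgt; apply/negP => X0.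
  have [N0 hN] := MA_approx i X0.
  have := hN N0.+1 (leqnSn _).
  rewrite (_ : (fun w => X i w - \sum_(0 <= k < N0.+1) _) = (fun w => X i w - b 0 * eps i w)).
    by rewrite ltxx.
  apply/funext => w; rewrite big_ltn// subr0 big_nat big1 ?addr0// => l /andP[l0 _].
  by rewrite bk ?mul0r.
apply: noproj; exists (fun=> 0); apply: is_proj_gen => //.
  exact/span_closed_span/span0.
move=> k /=; rewrite in_itv/= => kj.
under [X in inner P X]eq_fun do rewrite subr0.
(* Stationarity moves the pair to the indices 0 and [- l], where the pairing of [X 0] with the
   innovation is [b l] by definition. *)
have -> : X j = X (0 + j) by rewrite add0r.
have {1}-> : k = - `|j - k|%:Z + j by lia.
rewrite X_stat.2; set l := `|j - k|%N.
have Lb : L2 (fun w => b 0 * eps (- l%:Z) w) by exact: in_L2Z.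
have := inner_null (X_L2 0) (in_L2B (X_L2 _) Lb) (XE (- l%:Z)).
rewrite innerBr// innerZr// -/(b l) (bk l) ?mulr0 ?subr0//.
by rewrite /l; lia.
Qed.

Let innov_proj j : is_proj P X j `]-oo, j[ (Xhat P X j `]-oo, j[).
Proof. exact/Xhat_is_proj/past_proj_exists. Qed.

Lemma inner_innov_gt (i j : int) : i < j -> inner P (X i) (eps j) = 0.
Proof.
by move=> ij; apply: (residual_orth X_L2 (innov_proj j)) => /=; rewrite in_itv.
Qed.

Lemma innov_ortho (i j : int) : inner P (eps i) (eps j) = (i == j)%:R.
Proof.
have lt0 k l : k < l -> inner P (eps k) (eps l) = 0.
  move=> kl; have Sk : cspan [set i | i <= k] (eps k) by exact: innov_closed_span.
  rewrite innerC// (orth_closed_span X_L2 (eps_L2 l) _ Sk) ?conjC0// => i0 /= ik.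
  by rewrite innerC// inner_innov_gt ?conjC0//; lia.
case: (ltgtP i j) => [/lt0 //|/lt0 ji|<-].
  by rewrite innerC// ji conjC0.
exact/inner_normalize_diag/lt0r_neq0/X_pnd.1.
Qed.

(** [b] is defined at time 0, but the expansion of every [X i] uses the same coefficients.
    Orthonormality extracts [b k] from any partial sum beyond lag [k], and Cauchy-Schwarz bounds the
    rest by the approximation error. *)
Lemma inner_innov_MA (i : int) (k : nat) : inner P (X i) (eps (i - k%:Z)) = b k.
Proof.
set v := eps _; apply/eqP; rewrite -subr_eq0; apply/eqP/eq0_normc/le_anti.
rewrite normc_ge0 andbT; apply/ler_addgt0Pr => e e0; rewrite add0r.
have [N0 hN] := MA_approx i e0; pose N := (N0 + k.+1)%N.
have Lv : L2 v by exact: eps_L2.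
have Ev : inner P (MA_sum i 0 N) v = b k.
  rewrite /MA_sum inner_suml// (bigD1_seq k) ?iota_uniq ?mem_index_iota//=; last by rewrite /N; lia.
  rewrite innov_ortho eqxx mulr1 big1 ?addr0// => l lk.
  rewrite innov_ortho (_ : _ == _ = false) ?mulr0//; apply/negbTE.
  by apply: contra_neq lk; lia.
have nv : nrm v = 1.
  apply/eqP; rewrite -(eqrXn2 (n := 2))// ?L2norm_ge0//; apply/eqP/(@complexI R).
  by rewrite -inner_diag innov_ortho eqxx expr1n.
rewrite -Ev -innerBl//; apply: le_trans (inner_le _ _) _ => //; first exact: in_L2B.
by rewrite nv mulr1; exact/ltW/hN/leq_addr.
Qed.

Theorem infinite_past_interpolation (a : nat -> R[i]) (n : nat) :
  AR_coefs P X a ->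
  let S : set int := `]-oo, n%:Z] `\ 0 in
  let s : R := (\sum_(0 <= k < n.+1) normc (a k) ^+ 2)^-1 in
  sigma2 P X S = s /\
  {ae P, forall w, X 0 w - Xhat P X 0 S w =
     s%:C * \sum_(0 <= k < n.+1) (a k)^* * eps k%:Z w}.
Proof.
move=> aAR S s; apply: (interpolation_error X_L2 (e := fun k => eps k%:Z)).
- by rewrite /= in_itv.
- by move=> k kn; apply: innov_closed_span => l /=; rewrite in_itv/=; lia.
- by move=> j k _ _; rewrite innov_ortho; congr (_%:R); lia.
- move=> [j|j] /=; rewrite in_itv/= => jn; last first.
    by rewrite big1// => k _; rewrite inner_innov_gt ?mulr0//; lia.
  rewrite (big_cat_nat (n := j.+1))//=.
  rewrite [X in _ + X]big1_seq ?addr0; last first.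
    move=> k; rewrite mem_index_iota => /andP[_ /andP[jk _]].
    by rewrite inner_innov_gt ?mulr0//; lia.
  have -> : ((Posz j == 0)%:R : R[i]) = (j == 0%N)%:R by [].
  (* Reversing the convolution pairs [a k] with [b (j - k)], the pairing of [X j] with the
     innovation at [k]. *)
  rewrite -(aAR j) big_nat_rev/= add0n; apply: eq_big_nat => k /andP[_ kj].
  rewrite subSS mulrC; congr (_ * _).
  by rewrite -(inner_innov_MA j%:Z); congr (inner P _ (eps _)); lia.
Qed.

End infinite_past.

Theorem mainTheorem5 (d : measure_display) (T : measurableType d)
    (R : realType) (P : probability T R) (X : int -> T -> R[i])
    (a : nat -> R[i]) (afin : nat -> nat -> R[i]) (n : nat)
    (X_mean : zero_mean P X)
    (X_stat : weakly_stationary P X)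
    (X_pnd : purely_nondeterministic P X)
    (a_AR : AR_coefs P X a)
    (afin_AR : fin_AR_coefs P X afin) :
  (forall m : nat,
    let K : set int := `[- m%:Z, n%:Z] `\ 0 in
    let s : R := (\sum_(0 <= k < n.+1) normc (afin k (m + k)%N) ^+ 2)^-1 in
    sigma2 P X K = s /\
    {ae P, forall w, X 0 w - Xhat P X 0 K w =
       real_complex R s *
       \sum_(0 <= k < n.+1) (afin k (m + k)%N)^* * fin_innov P X m k%:Z w}) /\
  (let S : set int := `]-oo, n%:Z] `\ 0 in
   let s : R := (\sum_(0 <= k < n.+1) normc (a k) ^+ 2)^-1 in
   sigma2 P X S = s /\
   {ae P, forall w, X 0 w - Xhat P X 0 S w =
      real_complex R s *
      \sum_(0 <= k < n.+1) (a k)^* * innov P X k%:Z w}).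
Proof.
split=> [m|].
  exact: finite_past_interpolation.
exact: infinite_past_interpolation.
Qed.
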